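(* For any weight function $\mathbf L:W\to\mathbb N$ there exists a canonical basis $\mathfrak B^{\imath\imath}_{n,d}=\{\{A\}^{\mathbf L}:A\in\Xi^{\imath\imath}\}$ of $\mathbb S^{\imath\imath,\mathbf L}$ such that for all $A\in\Xi^{\imath\imath}$ $$\overline{\{A\}^{\mathbf L}}=\{A\}^{\mathbf L},\qquad\{A\}^{\mathbf L}\in[A]^{\mathbf L}+\sum_{B\in\Xi^{\imath\imath},\,B<_{\mathrm{alg}}A}\boldsymbol v^{-c}\,\mathbb Z[\boldsymbol v^{-c}]\,[B]^{\mathbf L},$$ where $c=\gcd(|\mathbf L(s_0)-\mathbf L(s_d)|,\ \mathbf L(s_0)+\mathbf L(s_d),\ \mathbf L(s_1))$. Moreover, $\mathfrak B^{\imath\imath}_{n,d}=\mathfrak B^{\mathfrak c}_{n,d}\cap\mathbb S^{\imath\imath,\mathbf L}$, where $\mathfrak B^{\mathfrak c}_{n,d}$ is the canonical basis of $\mathbb S^{\mathfrak c,\mathbf L}_{n,d}$. Here $\Xi^{\imath\imath}=\{A\in\Xi_{n,d}:\mathrm{row}_{\mathfrak c}(A)_k=0=\mathrm{col}_{\mathfrak c}(A)_k\text{ for }k=0,r+1\}$ and $\mathbb S^{\imath\imath}=\mathrm{End}_{\mathbb H}\big(\bigoplus_{\lambda\in\Lambda,\ \lambda_{0}=\lambda_{r+1}=0}x_\lambda\mathbb H\big)\subset\mathbb S^{\mathfrak c}_{n,d}$.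
   Context: **Weyl group.** Fix integers $r\ge 0$, $d\ge 2$; $n=2r+2$, $D=2d+2$, $\mathbb N=\{0,1,\dots\}$. $W$ is the group of permutations $g$ of $\mathbb Z$ with $g(i+D)=g(i)+D$, $g(-i)=-g(i)$ (affine Weyl group of type $\widetilde C_d$). Let $(i,j)_{\mathfrak c}$ swap $kD+i\leftrightarrow kD+j$ and $kD-i\leftrightarrow kD-j$ for all $k$ and fix other integers; Coxeter generators: $s_0=(1,-1)_{\mathfrak c}$, $s_i=(i,i+1)_{\mathfrak c}$ ($1\le i\le d-1$), $s_d=(d,d+2)_{\mathfrak c}$; $\ell$ is the length. $\Lambda$ is the set of $\lambda=(\lambda_0,\dots,\lambda_{r+1})\in\mathbb N^{r+2}$ with sum $d$; $\lambda_{0,i}=\lambda_0+\cdots+\lambda_i$; $W_\lambda$ is generated by $\{s_0,\dots,s_d\}\setminus\{s_{\lambda_0},s_{\lambda_{0,1}},\dots,s_{\lambda_{0,r}}\}$; $\mathscr D_\lambda=\{g:\ell(wg)=\ell(w)+\ell(g)\ \forall w\in W_\lambda\}$; $\mathscr D_{\lambda\mu}=\mathscr D_\lambda\cap\mathscr D_\mu^{-1}$. $R^\lambda_0=[-\lambda_0..\lambda_0]$, $R^\lambda_i=[\lambda_{0,i-1}+1..\lambda_{0,i}]$ ($1\le i\le r$), $R^\lambda_{r+1}=[d+1-\lambda_{r+1}..d+1+\lambda_{r+1}]$, $R^\lambda_{-i}=-R^\lambda_i$, $R^\lambda_{i+n}=R^\lambda_i+D$. **Matrices.** $\Xi_{n,d}$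 is the set of $\mathbb Z\times\mathbb Z$ matrices $A=(a_{ij})$ over $\mathbb N$ with $a_{-i,-j}=a_{ij}=a_{i+n,j+n}$, $a_{00},a_{r+1,r+1}$ odd, $\sum_{i=1}^n\sum_ja_{ij}=D$. $a'_{ii}=\frac12(a_{ii}-1)$ if $i\equiv0,r+1\pmod n$, $a'_{ij}=a_{ij}$ otherwise. $\mathrm{row}_{\mathfrak c}(A)$ has entries (indices $0$; $1\le k\le r$; $r+1$) $a'_{00}+\sum_{j\ge1}a_{0j}$; $\sum_ja_{kj}$; $a'_{r+1,r+1}+\sum_{j\le r}a_{r+1,j}$; $\mathrm{col}_{\mathfrak c}(A)=\mathrm{row}_{\mathfrak c}(A^{\mathrm{transpose}})$. Bijection $\kappa:\bigsqcup_{\lambda,\mu\in\Lambda}\{\lambda\}\times\mathscr D_{\lambda\mu}\times\{\mu\}\to\Xi_{n,d}$, $\kappa(\lambda,g,\mu)=(|R^\lambda_i\cap gR^\mu_j|)$. $A\le_{\mathrm{alg}}B$ iff $\mathrm{row}_{\mathfrak c}(A)=\mathrm{row}_{\mathfrak c}(B)$, $\mathrm{col}_{\mathfrak c}(A)=\mathrm{col}_{\mathfrak c}(B)$ and $\sum_{x\le i,y\ge j}a_{xy}\le\sum_{x\le i,y\ge j}b_{xy}$ for all $i<j$; $<_{\mathrm{alg}}$ is the strict version. **Hecke and Schur algebras.** $\mathbb A=\mathbb Z[q^{\pm1/2},q_0^{\pm1/2},q_1^{\pm1/2}]$; $\mathbb H$ is the $\mathbb A$-algebra generated by $T_0,\dots,T_d$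 with the braid relations of $W$ and $(T_0-q_0^{-1})(T_0+q_1)=0$, $(T_i-q^{-1})(T_i+q)=0$ ($1\le i\le d-1$), $(T_d-q_1^{-1})(T_d+q_0^{-1})=0$. $T_w$, $q_w$ are multiplicative along reduced words, $q_{s_0}=q_1$, $q_{s_i}=q$ ($1\le i\le d-1$), $q_{s_d}=q_0^{-1}$. $T_X=\sum_{w\in X}q_w^{-1}T_w$, $x_\lambda=T_{W_\lambda}$. $\mathbb S^{\mathfrak c}_{n,d}=\mathrm{End}_{\mathbb H}(\bigoplus_{\lambda\in\Lambda}x_\lambda\mathbb H)$ has $\mathbb A$-basis $e_A$ ($A=\kappa(\lambda,g,\mu)$), $e_A(x_\nu)=\delta_{\mu\nu}T_{W_\lambda gW_\mu}$. Standard basis: $[A]=q_0^{\frac12(\hat\ell_{\mathfrak c_0}(A)-\hat\ell_{\mathfrak c_d}(A))}q_1^{\frac12(\hat\ell_{\mathfrak c_0}(A)+\hat\ell_{\mathfrak c_d}(A))}q^{\hat\ell_{\mathfrak a}(A)}e_A$, where $\hat\ell_{\mathfrak c_0}(A)=\frac12(\sum_{x\le0,y>0}+\sum_{x\ge0,y<0})a_{xy}$, $\hat\ell_{\mathfrak c_d}(A)=\frac12(\sum_{x\le r+1,y>r+1}+\sum_{x\ge r+1,y<r+1})a_{xy}$, $\hat\ell_{\mathfrak a}(A)=\frac12\sum_{(i,j)\in I^+}(\sum_{x\le i,y>j}+\sum_{x\ge i,y<j})a''_{ij}a_{xy}$, $I^+=(\{0\}\times\mathbb N)\sqcup([1..r]\times\mathbb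 Z)\sqcup(\{r+1\}\times\mathbb Z_{\le r+1})$, $a''_{ii}=\frac12(a_{ii}-3)$ for $i=0,r+1$, $a''_{ij}=a_{ij}$ otherwise. $\mathbb S^{\imath\imath}$ is naturally a (non-unital) subalgebra with basis $\{[A]:A\in\Xi^{\imath\imath}\}$. **Bar involution.** On $\mathbb H$: inverts $q^{1/2},q_0^{1/2},q_1^{1/2}$, $\overline{T_w}=T_{w^{-1}}^{-1}$. On $\mathbb S^{\mathfrak c}_{n,d}$: $\overline f(x_\mu)=\overline{f(\overline{x_\mu})}$ for $f\in\mathrm{Hom}_{\mathbb H}(x_\mu\mathbb H,x_\lambda\mathbb H)$. **Specialization.** A weight function $\mathbf L:W\to\mathbb N$ satisfies $\mathbf L(ww')=\mathbf L(w)+\mathbf L(w')$ whenever $\ell(ww')=\ell(w)+\ell(w')$. A superscript $\mathbf L$ denotes base change to $\mathbb Z[\boldsymbol v^{\pm1/2}]$ along $q\mapsto\boldsymbol v^{-\mathbf L(s_1)}$, $q_0\mapsto\boldsymbol v^{-\mathbf L(s_0)+\mathbf L(s_d)}$, $q_1\mapsto\boldsymbol v^{-\mathbf L(s_0)-\mathbf L(s_d)}$ (and square roots), with bar $\boldsymbol v^{1/2}\mapsto\boldsymbol v^{-1/2}$. The canonical basis $\mathfrak B^{\mathfrak c}_{n,d}=\{\{A\}^{\mathbf L}:A\in\Xi_{n,d}\}$ of $\mathbb S^{\mathfrak c,\mathbf L}_{n,d}$ is characterized by consisting of bar-invariant elements with $\{A\}^{\mathbf L}\in[A]^{\mathbf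 L}+\sum_{B\in\Xi_{n,d},\,B<_{\mathrm{alg}}A}\boldsymbol v^{-c}\mathbb Z[\boldsymbol v^{-c}][B]^{\mathbf L}$, with the same $c$.
   Formalization: The existence of the canonical basis 𝔅^𝔠 of S^{𝔠,L} with the stated c is assumed, and the claim is proved for every such 𝔅^𝔠. For some L none exists: with r=d=2, L(s_0)=L(s_2)=1, L(s_1)=2 one gets c=2, and neither 𝔅^𝔠 nor 𝔅^ıı exists. *)

(* Defs.v *)
From HB Require Import structures.
From mathcomp Require Import all_boot all_order all_algebra.
From mathcomp Require Import generic_quotient finmap.
From mathcomp Require Import boolp classical_sets functions cardinality fsbigop.
From mathcomp.multinomials Require Import monalg.

Set Implicit Arguments.
Unset Strict Implicit.
Unset Printing Implicit Defensive.

Import Order.TTheory GRing.Theory Num.Theory.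
Local Open Scope ring_scope.
Local Open Scope classical_set_scope.
Local Open Scope quotient_scope.

(* The group ring Z[G] of an additive group G. Laurent polynomials in k       *)
(* variables are Z[Z^k]. The monoid algebras of monalg.v do not apply: a      *)
(* monomType has no invertible element but 1.                                 *)
Definition grpring (G : zmodType) : Type := {malg int[G]}.
HB.instance Definition _ (G : zmodType) := GRing.Zmodule.on (grpring G).

(* Sealed, like the products and scalings below, because conversion checks    *)
(* that unfold them do not terminate in practice.                             *)
HB.lock Definition gmon (G : zmodType) (g : G) : grpring G := << g >>.

HB.lock Definition gmul (G : zmodType) (x y : grpring G) : grpring G :=
  \sum_(a <- msupp x) \sum_(b <- msupp y) << x@_a * y@_b *g a + b >>.

Section GroupRing.
Variable G : zmodType.
Local Notation grpring := (grpring G).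
Local Notation gmul := (@gmul G).
Implicit Types x y z : grpring.

Lemma gmulEw (d1 d2 : {fset G}) x y :
  (msupp x `<=` d1)%fset -> (msupp y `<=` d2)%fset ->
  gmul x y = \sum_(a <- d1) \sum_(b <- d2) << x@_a * y@_b *g a + b >>.
Proof.
move=> le1 le2; rewrite gmul.unlock (big_fset_incl _ le1) /=.
  apply/eq_bigr=> k1 _; apply/big_fset_incl => // k _ /mcoeff_outdom ->.
  by rewrite mulr0 monalgU0.
move=> k _ /mcoeff_outdom xk.
by rewrite big1 => // k' _; rewrite xk mul0r monalgU0.
Qed.

Lemma gmulC : commutative gmul.
Proof.
move=> x y; rewrite gmul.unlock exchange_big /=.
by apply: eq_bigr => a _; apply: eq_bigr => b _; rewrite mulrC addrC.
Qed.

Lemma gmulDl : left_distributive gmul +%R.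
Proof.
move=> x y z.
rewrite (gmulEw (msuppD_le x y) (fsubset_refl _)).
rewrite (gmulEw (fsubsetUl _ (msupp y)) (fsubset_refl (msupp z))).
rewrite (gmulEw (fsubsetUr (msupp x) _) (fsubset_refl (msupp z))).
rewrite -big_split /=; apply: eq_bigr => a _.
rewrite -big_split /=; apply: eq_bigr => b _.
by rewrite mcoeffD mulrDl monalgUD.
Qed.

Lemma gmulDr : right_distributive gmul +%R.
Proof. by move=> x y z; rewrite gmulC gmulDl !(gmulC x). Qed.

Lemma gmul0 : left_zero (0 : grpring) gmul.
Proof. by move=> x; rewrite gmul.unlock msupp0 big_seq_fset0. Qed.

Lemma gmulUU m n a b :
  gmul << m *g a >> << n *g b >> = << m * n *g a + b >>.
Proof. by rewrite (gmulEw msuppU_le msuppU_le) !big_seq_fset1 !mcoeffUU. Qed.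

Lemma gmul_0 : right_zero (0 : grpring) gmul.
Proof. by move=> x; rewrite gmulC gmul0. Qed.

Lemma grpring_ind (P : grpring -> Prop) :
  P 0 -> (forall x y, P x -> P y -> P (x + y)) ->
  (forall m a, P << m *g a >>) -> forall x, P x.
Proof. by move=> P0 PD PU x; rewrite [x]monalgE; apply: big_ind. Qed.

Lemma gmulA : associative gmul.
Proof.
elim/grpring_ind => [y z|x x' IHx IHx' y z|m a].
- by rewrite !gmul0.
- by rewrite !gmulDl IHx IHx'.
elim/grpring_ind => [z|y y' IHy IHy' z|n b].
- by rewrite gmul_0 !gmul0 gmul_0.
- by rewrite gmulDl !gmulDr gmulDl IHy IHy'.
elim/grpring_ind => [|z z' IHz IHz'|p c].
- by rewrite !gmul_0.
- by rewrite !gmulDr IHz IHz'.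
by rewrite !gmulUU mulrA addrA.
Qed.

Lemma gmul1 : left_id (gmon (0 : G)) gmul.
Proof.
elim/grpring_ind => [|x x' IHx IHx'|m a]; first exact: gmul_0.
  by rewrite gmulDr IHx IHx'.
by rewrite gmon.unlock gmulUU mul1r add0r.
Qed.

Lemma gone_neq0 : gmon (0 : G) != 0.
Proof.
by rewrite gmon.unlock; apply/eqP/malgP=> /(_ 0) /eqP; rewrite mcoeffU eqxx mcoeff0.
Qed.

HB.instance Definition _ := GRing.Zmodule_isComNzRing.Build grpring
  gmulA gmulC gmul1 gmulDl gone_neq0.

End GroupRing.

(* The ring morphism Z[G] -> Z[G'] induced by an additive map h : G -> G'.    *)
Definition grpring_map (G G' : zmodType) (h : G -> G') (x : grpring G) :
    grpring G' := \sum_(g <- msupp x) << x@_g *g h g >>.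

Definition gbar (G : zmodType) (x : grpring G) : grpring G :=
  grpring_map -%R x.

(* Quotient of an R-module by the submodule generated by a set of relators.   *)
Section QuotientModuleDef.
Variables (R : nzRingType) (V : lmodType R) (rel : set V).

Definition submod_gen : {pred V} := fun x =>
  `[< forall P : {pred V}, GRing.submod_closed P ->
        (forall y, rel y -> y \in P) -> x \in P >].

Lemma submod_gen_closed : GRing.submod_closed submod_gen.
Proof.
split=> [|a u v /asboolP Pu /asboolP Pv]; apply/asboolP => P Pc relP.
  by case: Pc.
by case: (Pc) => _; apply; [exact: Pu | exact: Pv].
Qed.

HB.instance Definition _ := GRing.isZmodClosed.Build V submod_gen
  (GRing.submod_closedB submod_gen_closed).

Definition quotmod := Quotient.quot submod_gen.
HB.instance Definition _ := GRing.Zmodule.on quotmod.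
HB.instance Definition _ : EqQuotient V (Quotient.equiv submod_gen) quotmod :=
  EqQuotient.on quotmod.

Definition quotmod_pi (x : V) : quotmod := \pi x.

End QuotientModuleDef.

HB.lock Definition quotmod_scale (R : nzRingType) (V : lmodType R)
    (rel : set V) (a : R) (x : quotmod rel) : quotmod rel :=
  quotmod_pi rel (a *: repr x).

Section QuotientModule.
Variables (R : nzRingType) (V : lmodType R) (rel : set V).
Local Notation quotmod := (quotmod rel).
Local Notation quotmod_pi := (quotmod_pi rel).
Local Notation submod_gen := (submod_gen rel).
Local Notation quotmod_scale := (@quotmod_scale R V rel).

Lemma quotmod_piP x y : quotmod_pi x = quotmod_pi y <-> x - y \in submod_gen.
Proof.
rewrite Quotient.idealrBE; split=> [e|/eqP //]; exact/eqP.
Qed.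

Lemma quotmod_reprK x : quotmod_pi (repr x) = x.
Proof. exact: reprK. Qed.

Lemma quotmod_piD x y : quotmod_pi (x + y) = quotmod_pi x + quotmod_pi y.
Proof. exact: Quotient.pi_add. Qed.

Lemma quotmod_scaleE a x : quotmod_scale a (quotmod_pi x) = quotmod_pi (a *: x).
Proof.
rewrite quotmod_scale.unlock; apply/quotmod_piP; rewrite -scalerBr.
have [S0 SZ] := submod_gen_closed rel.
rewrite -[_ *: _]addr0; apply: SZ => //.
by apply/quotmod_piP; rewrite quotmod_reprK.
Qed.

Fact quotmod_scaleA a b x :
  quotmod_scale a (quotmod_scale b x) = quotmod_scale (a * b) x.
Proof. by rewrite -[x]quotmod_reprK !quotmod_scaleE scalerA. Qed.

Fact quotmod_scale1 : left_id 1 quotmod_scale.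
Proof. by move=> x; rewrite -[x]quotmod_reprK quotmod_scaleE scale1r. Qed.

Fact quotmod_scaleDr : right_distributive quotmod_scale +%R.
Proof.
move=> a x y; rewrite -[x]quotmod_reprK -[y]quotmod_reprK -quotmod_piD.
by rewrite !quotmod_scaleE -quotmod_piD scalerDr.
Qed.

Fact quotmod_scaleDl x : {morph quotmod_scale^~ x : a b / a + b}.
Proof.
move=> a b; rewrite -[x]quotmod_reprK !quotmod_scaleE.
by rewrite -quotmod_piD scalerDl.
Qed.

HB.instance Definition _ := GRing.Zmodule_isLmodule.Build R quotmod
  quotmod_scaleA quotmod_scale1 quotmod_scaleDr quotmod_scaleDl.

End QuotientModule.

(* The A-algebra presented by generators I and relators rel, i.e. the free    *)
(* A-algebra on I modulo the two-sided ideal generated by rel.                *)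
Section PresentedAlgebraDef.
Variables (A : comNzRingType) (I : choiceType).
Local Notation F := {malg A[{fmonom I}]}.

Definition fgen (i : I) : F := << fmu i >>.

Variable rel : set F.

Definition two_sided_ideal (J : {pred F}) : Prop :=
  zmod_closed J /\
  forall x y, y \in J -> (x * y \in J) /\ (y * x \in J).

Definition ideal_gen : {pred F} := fun x =>
  `[< forall J : {pred F}, two_sided_ideal J ->
        (forall y, rel y -> y \in J) -> x \in J >].

Lemma ideal_gen_ideal : two_sided_ideal ideal_gen.
Proof.
split=> [|x y /asboolP Jy].
  split=> [|u v /asboolP Ju /asboolP Jv]; apply/asboolP=> J JI relJ.
    by case: JI => -[].
  by case: (JI) => -[_ JB _]; apply: JB; [exact: Ju | exact: Jv].
split; apply/asboolP=> J JI relJ.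
  exact: (JI.2 x y (Jy J JI relJ)).1.
exact: (JI.2 x y (Jy J JI relJ)).2.
Qed.

HB.instance Definition _ := GRing.isZmodClosed.Build F ideal_gen
  ideal_gen_ideal.1.

Definition palg := Quotient.quot ideal_gen.
HB.instance Definition _ := GRing.Zmodule.on palg.
HB.instance Definition _ : EqQuotient F (Quotient.equiv ideal_gen) palg :=
  EqQuotient.on palg.

Definition palg_pi (x : F) : palg := \pi x.
Definition pgen (i : I) : palg := palg_pi (fgen i).

End PresentedAlgebraDef.

HB.lock Definition palg_mul (A : comNzRingType) (I : choiceType)
    (rel : set {malg A[{fmonom I}]}) (x y : palg rel) : palg rel :=
  palg_pi rel (repr x * repr y).

HB.lock Definition palg_scale (A : comNzRingType) (I : choiceType)
    (rel : set {malg A[{fmonom I}]}) (a : A) (x : palg rel) : palg rel :=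
  palg_pi rel (a *: repr x).

Section PresentedAlgebra.
Variables (A : comNzRingType) (I : choiceType).
Local Notation F := {malg A[{fmonom I}]}.
Variable rel : set F.
Local Notation palg := (palg rel).
Local Notation palg_pi := (palg_pi rel).
Local Notation ideal_gen := (ideal_gen rel).
Local Notation palg_mul := (@palg_mul A I rel).
Local Notation palg_scale := (@palg_scale A I rel).

Lemma palg_piP x y : palg_pi x = palg_pi y <-> x - y \in ideal_gen.
Proof. by rewrite Quotient.idealrBE; split=> [e|/eqP //]; exact/eqP. Qed.

Lemma palg_reprK x : palg_pi (repr x) = x.
Proof. exact: reprK. Qed.

Lemma palg_piD x y : palg_pi (x + y) = palg_pi x + palg_pi y.
Proof. exact: Quotient.pi_add. Qed.

Lemma fscalerAr (a : A) (x y : F) : a *: (x * y) = x * (a *: y).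
Proof.
rewrite -[a *: y]mul_malgC mulrA; suff -> : x * a%:MP = a *: x.
  by rewrite scalerAl.
rewrite malgM_def fgmulgU malgZ_def; apply: eq_bigr => i _.
by rewrite mulm1 mulrC.
Qed.


Lemma palg_mulE x y : palg_mul (palg_pi x) (palg_pi y) = palg_pi (x * y).
Proof.
set x' := palg_pi x; set y' := palg_pi y; have [[S0 SB] SM] := ideal_gen_ideal rel.
rewrite palg_mul.unlock; apply/palg_piP.
have -> : repr x' * repr y' - x * y =
  (repr x' - x) * repr y' - x * (y - repr y').
  by rewrite mulrBl mulrBr opprB addrA subrK.
apply: SB.
  by apply: (SM _ _ _).2; apply/palg_piP; rewrite palg_reprK.
by apply: (SM _ _ _).1; apply/palg_piP; rewrite palg_reprK.
Qed.

Lemma palg_scaleE a x : palg_scale a (palg_pi x) = palg_pi (a *: x).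
Proof.
rewrite palg_scale.unlock; apply/palg_piP; rewrite -scalerBr -mul_malgC.
by apply: ((ideal_gen_ideal rel).2 _ _ _).1; apply/palg_piP; rewrite palg_reprK.
Qed.

Fact palg_mulA : associative palg_mul.
Proof.
move=> x y z; rewrite -[x]palg_reprK -[y]palg_reprK -[z]palg_reprK.
by rewrite !palg_mulE mulrA.
Qed.

Fact palg_mul1 : left_id (palg_pi 1) palg_mul.
Proof. by move=> x; rewrite -[x]palg_reprK palg_mulE mul1r. Qed.

Fact palg_mulr1 : right_id (palg_pi 1) palg_mul.
Proof. by move=> x; rewrite -[x]palg_reprK palg_mulE mulr1. Qed.

Fact palg_mulDl : left_distributive palg_mul +%R.
Proof.
move=> x y z; rewrite -[x]palg_reprK -[y]palg_reprK -[z]palg_reprK.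
by rewrite -palg_piD !palg_mulE -palg_piD mulrDl.
Qed.

Fact palg_mulDr : right_distributive palg_mul +%R.
Proof.
move=> x y z; rewrite -[x]palg_reprK -[y]palg_reprK -[z]palg_reprK.
by rewrite -palg_piD !palg_mulE -palg_piD mulrDr.
Qed.

HB.instance Definition _ := GRing.Zmodule_isPzRing.Build palg
  palg_mulA palg_mul1 palg_mulr1 palg_mulDl palg_mulDr.

Fact palg_scaleA a b x : palg_scale a (palg_scale b x) = palg_scale (a * b) x.
Proof. by rewrite -[x]palg_reprK !palg_scaleE scalerA. Qed.

Fact palg_scale1 : left_id 1 palg_scale.
Proof. by move=> x; rewrite -[x]palg_reprK palg_scaleE scale1r. Qed.

Fact palg_scaleDr : right_distributive palg_scale +%R.
Proof.
move=> a x y; rewrite -[x]palg_reprK -[y]palg_reprK -palg_piD.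
by rewrite !palg_scaleE -palg_piD scalerDr.
Qed.

Fact palg_scaleDl x : {morph palg_scale^~ x : a b / a + b}.
Proof.
by move=> a b; rewrite -[x]palg_reprK !palg_scaleE -palg_piD scalerDl.
Qed.

HB.instance Definition _ := GRing.Zmodule_isLmodule.Build A palg
  palg_scaleA palg_scale1 palg_scaleDr palg_scaleDl.

Lemma palg_scaleAl (a : A) (x y : palg) : a *: (x * y) = a *: x * y.
Proof.
rewrite -[x]palg_reprK -[y]palg_reprK.
rewrite [in RHS]/GRing.scale /= [in LHS]/GRing.mul /=.
rewrite palg_scaleE palg_mulE [in RHS]/GRing.mul /= palg_mulE.
by rewrite [LHS]palg_scaleE scalerAl.
Qed.

Lemma palg_scaleAr (a : A) (x y : palg) : a *: (x * y) = x * (a *: y).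
Proof.
rewrite -[x]palg_reprK -[y]palg_reprK.
rewrite [in RHS]/GRing.scale /= [in LHS]/GRing.mul /=.
rewrite palg_scaleE palg_mulE [in RHS]/GRing.mul /= palg_mulE.
by rewrite [LHS]palg_scaleE fscalerAr.
Qed.

Lemma palg_one_neq0 (chi : {rmorphism F -> A}) :
  (forall y, rel y -> chi y = 0) -> (1 : palg) != 0.
Proof.
move=> chirel; apply/eqP => e.
have {e} : palg_pi 1 = palg_pi 0.
  rewrite [LHS]e; apply: (addrI (palg_pi 0)).
  by rewrite -palg_piD !addr0.
move=> /palg_piP; rewrite subr0 => /asboolP /(_ (fun x => chi x == 0)) contra.
suff : (1 : F) \in (fun x => chi x == 0) by rewrite unfold_in rmorph1 oner_eq0.
apply: contra => [|y rely]; last by rewrite unfold_in chirel.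
split; first split; first by rewrite unfold_in rmorph0.
  move=> x y; rewrite !unfold_in => /eqP x0 /eqP y0.
  by rewrite rmorphB x0 y0 subrr.
move=> x y /eqP y0; split; apply/eqP; rewrite rmorphM y0.
  exact: mulr0.
exact: mul0r.
Qed.

Section CommutativeCharacter.
Variables (B : nzRingType) (chi : {rmorphism B -> A}).
Implicit Types x y z : B.

Lemma char_quad x y z : chi x = chi y -> chi ((x - y) * z) = 0.
Proof. by move=> e; rewrite rmorphM rmorphB e subrr mul0r. Qed.

Lemma char_comm x y : chi (x * y - y * x) = 0.
Proof. by rewrite rmorphB !rmorphM mulrC subrr. Qed.

Lemma char_braid3 x y : chi x = chi y -> chi (x * y * x - y * x * y) = 0.
Proof. by move=> e; rewrite rmorphB !rmorphM e subrr. Qed.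

Lemma char_braid4 x y : chi (x * y * x * y - y * x * y * x) = 0.
Proof.
by rewrite rmorphB !rmorphM [chi x * _ * _ * _]mulrC !mulrA subrr.
Qed.

End CommutativeCharacter.

End PresentedAlgebra.

(* The affine Weyl group W of type C_d: its elements are functions int -> int *)
(* (the set affW), its product is composition.                                *)
Section WeylGroup.
Variable d : nat.

Definition period : int := (2 * d + 2)%:Z.

Definition affW : set (int -> int) :=
  [set g | [/\ bijective g, forall i, g (i + period) = g i + period
             & forall i, g (- i) = - g i]].

Definition swapC (i j x : int) : int :=
  if (x == i %[mod period])%Z then x + (j - i)
  else if (x == j %[mod period])%Z then x + (i - j)
  else if (x == - i %[mod period])%Z then x + (i - j)
  else if (x == - j %[mod period])%Z then x + (j - i)
  else x.

Definition sgen (i : 'I_d.+1) : int -> int :=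
  if i == ord0 then swapC 1 (- 1)
  else if i == ord_max then swapC d (d + 2)%N
  else swapC i i.+1.

Definition word (s : seq 'I_d.+1) : int -> int :=
  foldr (fun i g => sgen i \o g) id s.

Definition reduced (s : seq 'I_d.+1) : Prop :=
  forall s', word s' = word s -> (size s <= size s')%N.

(* A reduced word of g; none exists when g is not in W.                       *)
Definition redword (g : int -> int) : seq 'I_d.+1 :=
  xget [::] [set s | word s = g /\ reduced s].

Definition len (g : int -> int) : nat := size (redword g).

Definition weight_function (L : (int -> int) -> nat) : Prop :=
  forall w w', affW w -> affW w' -> len (w \o w') = (len w + len w')%N ->
    L (w \o w') = (L w + L w')%N.

End WeylGroup.

(* Weak compositions of d into r + 2 parts; the parts are bounded by d.       *)
Definition comp (r d : nat) : Type :=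
  {l : {ffun 'I_r.+2 -> 'I_d.+1} | (\sum_i l i)%N == d}.
HB.instance Definition _ r d := Finite.on (comp r d).

Section Parabolic.
Variables r d : nat.
Implicit Types l m : comp r d.

Definition part l (k : nat) : nat := val l (inord k).

Definition psum l (k : nat) : nat := (\sum_(i < k.+1) part l i)%N.

Definition parab_gen l : pred 'I_d.+1 :=
  fun j => [forall i : 'I_r.+1, psum l i != j].

(* Generated as a monoid, hence as a group: the generators are involutions.   *)
Definition parab l : set (int -> int) :=
  [set w | exists2 s : seq 'I_d.+1, all (parab_gen l) s & w = word s].

Definition distl l : set (int -> int) :=
  [set g | affW d g /\
     forall w, parab l w -> len d (w \o g) = (len d w + len d g)%N].

Definition dist l m : set (int -> int) :=
  [set g | distl l g /\ exists h, [/\ cancel g h, cancel h g & distl m h]].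

Definition dcoset l (g : int -> int) m : set (int -> int) :=
  [set w | exists u v, [/\ parab l u, parab m v & w = u \o g \o v]].

(* R^l_k for 0 <= k <= r + 1.                                                 *)
Definition block0 l (k : nat) : set int :=
  if k == 0%N then [set x | - (part l 0)%:Z <= x <= (part l 0)%:Z]
  else if k == r.+1 then
    [set x | (d.+1)%:Z - (part l k)%:Z <= x <= (d.+1)%:Z + (part l k)%:Z]
  else [set x | (psum l k.-1).+1%:Z <= x <= (psum l k)%:Z].

Definition msize : int := (2 * r + 2)%:Z.

(* R^l_i for all i, from R_(-k) = - R_k and R_(i + n) = R_i + D: here         *)
(* i = q * n + k with 0 <= k < n.                                             *)
Definition block l (i : int) : set int :=
  let q := (i %/ msize)%Z in let k := `|(i %% msize)%Z|%N in
  if (k <= r.+1)%N then [set x | block0 l k (x - q * period d)]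
  else [set x | block0 l (2 * r + 2 - k)%N (period d - (x - q * period d))].

End Parabolic.

Definition zmat : Type := int -> int -> nat.
HB.instance Definition _ := Choice.on zmat.

Section Matrices.
Variables r d : nat.
Local Notation n := (msize r).
Local Notation r1 := (r.+1%:Z).
Implicit Types A B : zmat.

(* Sums over subsets of Z and of Z x Z; \big over a set is a sum over the     *)
(* (finite) support, and would be 0 for an infinite one.                      *)
Definition sum1 (X : set int) (f : int -> nat) : nat :=
  \big[addn/0%N]_(j \in X) f j.
Definition sum2 (X : set (int * int)) A : nat :=
  \big[addn/0%N]_(p \in X) A p.1 p.2.

(* The rows must be finitely supported for the last sum to make sense.        *)
Definition Xi : set zmat := [set A |
  [/\ forall i j, A (- i) (- j) = A i j,
      forall i j, A (i + n) (j + n) = A i j,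
      odd (A 0 0) && odd (A r1 r1),
      forall i, finite_set [set j | A i j != 0%N]
    & (\sum_(1 <= i < (2 * r + 2).+1) sum1 setT (A i))%N = (2 * d + 2)%N]].

Definition aprime A (i j : int) : nat :=
  if (i == j) && ((i == 0 %[mod n])%Z || (i == r1 %[mod n])%Z)
  then (A i j).-1./2 else A i j.

Definition rowc A : {ffun 'I_r.+2 -> nat} := [ffun k : 'I_r.+2 =>
  if k == ord0 then (aprime A 0 0 + sum1 [set j | (1 <= j)%R] (A 0))%N
  else if k == ord_max then
    (aprime A r1 r1 + sum1 [set j | (j <= r%:Z)%R] (A r1))%N
  else sum1 setT (A k)].

Definition colc A := rowc (fun i j => A j i).

Definition corner (i j : int) : set (int * int) :=
  [set p | p.1 <= i /\ p.2 >= j].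

Definition alg_le A B : Prop :=
  [/\ rowc A = rowc B, colc A = colc B &
      forall i j : int, i < j ->
        (sum2 (corner i j) A <= sum2 (corner i j) B)%N].

Definition alg_lt A B : Prop := alg_le A B /\ A <> B.

Definition Xi_ii : set zmat := [set A | Xi A /\
  forall k, k = ord0 \/ k = ord_max -> rowc A k = 0%N /\ colc A k = 0%N].

Definition kappa (l : comp r d) (g : int -> int) (m : comp r d) : zmat :=
  fun i j => #|` fset_set (block l i `&` g @` block m j) |.

Definition sum_ur A (i j : int) : nat :=
  sum2 [set p | p.1 <= i /\ p.2 > j] A.
Definition sum_dl A (i j : int) : nat :=
  sum2 [set p | p.1 >= i /\ p.2 < j] A.

(* For A in Xi the two sums of hatl_c0 (resp. hatl_cd) are equal, by          *)
(* (x, y) -> (- x, - y) (resp. (n - x, n - y)), so the halves are exact.      *)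
Definition hatl_c0 A : nat := (sum_ur A 0 0 + sum_dl A 0 0)./2.
Definition hatl_cd A : nat := (sum_ur A r1 r1 + sum_dl A r1 r1)./2.

Definition Iplus : set (int * int) := [set p |
  [\/ p.1 = 0 /\ 0 <= p.2, 1 <= p.1 <= r%:Z | p.1 = r1 /\ p.2 <= r1]].

(* May be - 1.                                                                *)
Definition adprime A (i j : int) : int :=
  if (i == j) && ((i == 0) || (i == r1)) then (((A i j)%:Z - 3) %/ 2)%Z
  else A i j.

(* Twice hatl_a, i.e. the exponent of q^(1/2) in q^(hatl_a A).                *)
Definition hatl_a_dbl A : int := \sum_(p \in Iplus)
  adprime A p.1 p.2 * (sum_ur A p.1 p.2 + sum_dl A p.1 p.2)%:Z.

End Matrices.

(* gmon (a, b, c) is q^(a/2) q_0^(b/2) q_1^(c/2).                             *)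
Definition laurent3 : comNzRingType := grpring (int * int * int)%type.

Section Hecke.
Variable d : nat.
Local Notation t i := (@fgen laurent3 'I_d.+1 i).

(* The exponent of q_(s_i); note that - q_(s_i) is a root of the quadratic    *)
(* relation of T_i.                                                           *)
Definition qexp_gen (i : 'I_d.+1) : int * int * int :=
  if i == ord0 then (0, 0, 2) else if i == ord_max then (0, - 2, 0)
  else (2, 0, 0).

Definition root_exp (i : 'I_d.+1) : int * int * int :=
  if i == ord0 then (0, - 2, 0) else if i == ord_max then (0, 0, - 2)
  else (- 2, 0, 0).

(* The braid relations of type C~_d are those of the diagram                  *)
(* 0 =4= 1 --- 2 --- ... --- d-1 =4= d, for d >= 2.                           *)
Inductive hecke_rel : set {malg laurent3[{fmonom 'I_d.+1}]} :=
| hecke_quad i :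
    hecke_rel ((t i - (gmon (root_exp i))%:MP)
               * (t i + (gmon (qexp_gen i))%:MP))
| hecke_comm (i j : 'I_d.+1) : (i.+1 < j)%N ->
    hecke_rel (t i * t j - t j * t i)
| hecke_braid3 (i j : 'I_d.+1) : (0 < i)%N -> j = i.+1 :> nat -> (j < d)%N ->
    hecke_rel (t i * t j * t i - t j * t i * t j)
| hecke_braid4 (i j : 'I_d.+1) : j = i.+1 :> nat -> i = ord0 \/ j = ord_max ->
    hecke_rel (t i * t j * t i * t j - t j * t i * t j * t i).

Definition hecke : Type := palg hecke_rel.
HB.instance Definition _ := GRing.PzRing.on hecke.
HB.instance Definition _ := GRing.Lmodule.on hecke.

Definition Tgen (i : 'I_d.+1) : hecke := pgen hecke_rel i.

(* H <> 0: every T_i acts on laurent3 by root_exp i.                          *)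
Section Nontrivial.

Let ch (w : {fmonom 'I_d.+1}) : laurent3 := \prod_(i <- w) gmon (root_exp i).

Fact hecke_char_mmorph : mmorphism ch.
Proof.
split=> [u v|]; rewrite /ch; first by rewrite fmM big_cat.
by rewrite fm1 big_nil.
Qed.

HB.instance Definition _ := isMultiplicative.Build _ _ ch hecke_char_mmorph.

Let chi : {rmorphism {malg laurent3[{fmonom 'I_d.+1}]} -> laurent3} :=
  mmap idfun ch.

Fact hecke_one_neq0 : (1 : hecke) != 0.
Proof.
have chit i : chi (t i) = gmon (root_exp i).
  by rewrite /chi /= /fgen mmapU mul1r /= /ch fmU big_seq1.
have chiC c : chi c%:MP = c by exact: mmapC.
apply: (palg_one_neq0 (chi := chi)) => _ [i|i j _|i j i0 ji jd|i j _ _].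
- apply: (@char_quad laurent3 _ chi); exact: (etrans (chit i) (esym (chiC _))).
- exact: (@char_comm laurent3 _ chi).
- have nm (k : 'I_d.+1) : (0 < k < d)%N -> root_exp k = (- 2, 0, 0).
    move=> /andP[k0 kd]; rewrite /root_exp -!val_eqE /=.
    by rewrite gtn_eqF // ltn_eqF.
  apply: (@char_braid3 laurent3 _ chi).
  have j0 : (0 < j)%N by rewrite ji.
  have id : (i < d)%N by rewrite (ltn_trans _ jd) // ji.
  by rewrite [LHS]chit [RHS]chit (nm i) ?i0 ?id // (nm j) ?j0 ?jd.
- exact: (@char_braid4 laurent3 _ chi).
Qed.

End Nontrivial.

HB.instance Definition _ :=
  GRing.PzSemiRing_isNonZero.Build hecke hecke_one_neq0.
HB.instance Definition _ := GRing.Lmodule_isLalgebra.Build laurent3 hecke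
  (@palg_scaleAl _ _ hecke_rel).
HB.instance Definition _ := GRing.Lalgebra_isAlgebra.Build laurent3 hecke
  (@palg_scaleAr _ _ hecke_rel).

Definition Tw (w : int -> int) : hecke := \prod_(i <- redword d w) Tgen i.

(* q_w = gmon (qexp w).                                                       *)
Definition qexp (w : int -> int) : int * int * int :=
  \sum_(i <- redword d w) qexp_gen i.

Definition Tsum (X : set (int -> int)) : hecke :=
  \sum_(w \in X) gmon (- qexp w) *: Tw w.

(* These two properties characterise the bar involution, since the T_w form   *)
(* an A-basis of H.                                                           *)
Definition is_hbar (b : hecke -> hecke) : Prop :=
  (forall (a : laurent3) x y, b (a *: x + y) = gbar a *: b x + b y) /\
  forall w w', affW d w -> affW d w' -> cancel w w' -> cancel w' w ->
    b (Tw w) * Tw w' = 1 /\ Tw w' * b (Tw w) = 1.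

Definition hbar : hecke -> hecke :=
  xget (idfun : {classic hecke -> hecke}) is_hbar.

End Hecke.

Section SchurAlgebra.
Variables r d : nat.
Local Notation H := (hecke d).
Local Notation comp := (comp r d).

Definition xl (l : comp) : H := Tsum d (parab l).

(* The right H-module (+)_l x_l H, as a submodule of the functions comp -> H. *)
Definition dsum_pred : {pred {ffun comp -> H}} := fun m =>
  `[< forall l, exists h, m l = xl l * h >].

Fact dsum_closed : GRing.subsemimod_closed dsum_pred.
Proof.
split=> [|a m /asboolP xm]; last first.
  apply/asboolP => l; have [h e] := xm l.
  by exists (a *: h); rewrite ffunE e scalerAr.
split=> [|m m' /asboolP xm /asboolP xm']; apply/asboolP => l.
  by exists 0; rewrite ffunE mulr0.
have [h e] := xm l; have [h' e'] := xm' l.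
by exists (h + h'); rewrite ffunE e e' mulrDr.
Qed.

HB.instance Definition _ :=
  GRing.isSubmodClosed.Build laurent3 {ffun comp -> H} dsum_pred dsum_closed.

Record dsum := Dsum { dsum_val : {ffun comp -> H}; _ : dsum_val \in dsum_pred }.
HB.instance Definition _ := [isSub for dsum_val].
HB.instance Definition _ := [Choice of dsum by <:].
HB.instance Definition _ := [SubChoice_isSubLmodule of dsum by <:].

Fact dsum_act_subproof (m : dsum) (h : H) :
  [ffun l => val m l * h] \in dsum_pred.
Proof.
apply/asboolP => l; have /asboolP/(_ l)[h' e] := valP m.
by exists (h' * h); rewrite ffunE e mulrA.
Qed.
Definition dsum_act (m : dsum) (h : H) : dsum := Dsum (dsum_act_subproof m h).

Fact dsum_in_subproof (k : comp) :
  [ffun l => if l == k then xl k else 0] \in dsum_pred.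
Proof.
apply/asboolP => l; rewrite ffunE; case: eqP => [->|_].
  by exists 1; rewrite mulr1.
by exists 0; rewrite mulr0.
Qed.
(* The generator x_k of the k-th summand.                                     *)
Definition dsum_gen (k : comp) : dsum := Dsum (dsum_in_subproof k).

(* S^c = End_H((+)_l x_l H).                                                  *)
Definition schur_pred : {pred dsum -> dsum} := fun f =>
  `[< (forall m m', f (m + m') = f m + f m') /\
      (forall m h, f (dsum_act m h) = dsum_act (f m) h) >].

Fact schur_closed : GRing.subsemimod_closed schur_pred.
Proof.
split=> [|a f /asboolP [fD fM]]; last first.
  apply/asboolP; split=> [m m'|m h]; first by rewrite !scalrfctE fD scalerDr.
  rewrite !scalrfctE fM; apply/val_inj/ffunP => l.
  by rewrite /= !ffunE /= scalerAl.
split=> [|f g /asboolP [fD fM] /asboolP [gD gM]]; apply/asboolP.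
  split=> [m m'|m h]; first by rewrite addr0.
  by apply/val_inj/ffunP => l; rewrite /= !ffunE mul0r.
split=> [m m'|m h]; rewrite !addrfctE ?fD ?gD; first by rewrite addrACA.
by rewrite fM gM; apply/val_inj/ffunP => l; rewrite /= !ffunE mulrDl.
Qed.

HB.instance Definition _ :=
  GRing.isSubmodClosed.Build laurent3 (dsum -> dsum) schur_pred schur_closed.

Record schur := Schur { schur_val :> dsum -> dsum; _ : schur_val \in schur_pred }.
HB.instance Definition _ := [isSub for schur_val].
HB.instance Definition _ := [Choice of schur by <:].
HB.instance Definition _ := [SubChoice_isSubLmodule of schur by <:].

Definition comp_ii (l : comp) : bool := (part l 0 == 0%N) && (part l r.+1 == 0%N).

(* S^ii as a subset of S^c: the endomorphisms that vanish on x_l H for l not  *)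
(* in Lambda^ii and have no component in these summands.                      *)
Definition schur_ii : set schur := [set f : schur |
  (forall m : dsum, (forall l, comp_ii l -> val m l = 0) -> f m = 0) /\
  (forall (m : dsum) l, ~~ comp_ii l -> val (f m) l = 0)].

(* The element e_A: kappa is a bijection, the x_k generate (+)_l x_l H, and   *)
(* T_(W_l g W_m) lies in x_l H, so exactly one f has this property.           *)
Definition is_eA (A : zmat) (f : schur) : Prop :=
  exists l g m, [/\ dist l m g, kappa l g m = A &
    forall k, val (f (dsum_gen k)) =
      [ffun l' => if (k == m) && (l' == l) then Tsum d (dcoset l g m) else 0]].

Definition eA (A : zmat) : schur := xget 0 (is_eA A).

Definition std (A : zmat) : schur :=
  gmon (hatl_a_dbl r A,
        (hatl_c0 A)%:Z - (hatl_cd r A)%:Z,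
        (hatl_c0 A)%:Z + (hatl_cd r A)%:Z) *: eA A.

Definition dsum_bar (m : dsum) : dsum :=
  insubd 0 [ffun l => hbar (val m l)].

(* The image of f under the bar involution; hbar (x_k) lies in x_k H, so      *)
(* insubd does not use its default value on the arguments below.              *)
Definition is_sbar (f g : schur) : Prop :=
  forall k, g (dsum_gen k) = dsum_bar (f (dsum_bar (dsum_gen k))).

Definition sbar (f : schur) : schur := xget 0 (is_sbar f).

End SchurAlgebra.

(* Extension of scalars R (x)_A M along phi : A -> R.                         *)
Section BaseChange.
Variables (A R : nzRingType) (phi : A -> R) (M : lmodType A).

Inductive tens_rel : set {malg R[M]} :=
| tens_add m m' : tens_rel (<< m + m' >> - << m >> - << m' >>)
| tens_scale a m : tens_rel (<< a *: m >> - phi a *: << m >>).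

Definition base_change : Type := quotmod tens_rel.
HB.instance Definition _ := GRing.Lmodule.on base_change.

(* 1 (x) m.                                                                   *)
Definition tens (m : M) : base_change := quotmod_pi tens_rel << m >>.

(* sum_i r_i (x) m_i |-> sum_i br r_i (x) bm m_i, for compatible semilinear   *)
(* br and bm; then it does not depend on the chosen representative.           *)
Definition tens_map (br : R -> R) (bm : M -> M) (x : base_change) :
    base_change :=
  let y := repr (x : quotmod tens_rel) in
  \sum_(m <- msupp y) br y@_m *: tens (bm m).

End BaseChange.

(* gmon k is v^(k/2).                                                         *)
Definition laurent1 : comNzRingType := grpring int.

Section Specialization.
Variables (r d : nat) (L : (int -> int) -> nat).
Local Notation Ls i := ((L (@sgen d i))%:Z).
Local Notation L0 := (Ls ord0).
Local Notation L1 := (Ls (inord 1)).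
Local Notation Ld := (Ls ord_max).

Definition spec_exp (e : int * int * int) : int :=
  - L1 * e.1.1 + (- L0 + Ld) * e.1.2 + (- L0 - Ld) * e.2.

Definition spec : laurent3 -> laurent1 := grpring_map spec_exp.

Definition wgcd : nat :=
  gcdn (gcdn (absz (L0 - Ld)%R) (absz (L0 + Ld)%R)) (absz L1).

(* v^(-c) Z[v^(-c)]; this is Z when c = 0.                                    *)
Definition vneg : set laurent1 := [set x | exists p : {poly int},
  let y : laurent1 := gmon (- (2 * wgcd)%:Z) in
  x = y * (map_poly intr p).[y]].

Definition schurL : lmodType laurent1 := base_change spec (schur r d).
Definition stdL (A : zmat) : schurL := tens spec (std r d A).
Definition barL : schurL -> schurL := tens_map (@gbar int) (@sbar r d).

(* The span of the image of S^ii, a direct summand of S^c.                    *)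
Definition schurL_ii : set schurL := [set x |
  exists s : seq (laurent1 * schur r d),
    (forall p, p \in s -> schur_ii p.2) /\
    x = \sum_(p <- s) p.1 *: tens spec p.2].

End Specialization.

Arguments schur_ii : clear implicits.
Arguments schurL_ii : clear implicits.

Section Bases.
Variables (R : nzRingType) (V : lmodType R) (I : choiceType).

(* x is the linear combination with coefficients a of the b i, i in X.        *)
Definition lincomb (X : set I) (a : I -> R) (b : I -> V) (x : V) : Prop :=
  [/\ finite_set [set i | a i != 0], (forall i, a i != 0 -> X i)
    & x = \sum_(i \in [set i | a i != 0]) a i *: b i].

Definition is_basis (N : set V) (X : set I) (b : I -> V) : Prop :=
  (forall i, X i -> N (b i)) /\
  (forall x, N x -> exists! a, lincomb X a b x).

End Bases.

Section CanonicalBases.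
Variables (r d : nat) (L : (int -> int) -> nat).

(* (b A), A in X, is a canonical basis of the submodule N.                    *)
Definition canonical_basis (N : set (schurL r d L)) (X : set zmat)
    (b : zmat -> schurL r d L) : Prop :=
  is_basis N X b /\
  forall A, X A ->
    barL (b A) = b A /\
    exists2 a, lincomb (X `&` [set B | alg_lt r B A]) a (stdL r d L)
                 (b A - stdL r d L A)
             & forall B, vneg d L (a B).

End CanonicalBases.

(* Main.v *)
From HB Require Import structures.
From mathcomp Require Import all_boot all_order all_algebra zify finmap.
From mathcomp.multinomials Require Import monalg.
From mathcomp Require Import boolp classical_sets cardinality fsbigop.
Require Import Defs.

(** The canonical basis of S^ii is the part of the canonical basis of S^c
    indexed by Xi^ii. The reason is that S^ii is cut out of S^c by an
    idempotent: if [p] is the projection of the direct sum of the x_l H onto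
    the summands with l_0 = l_(r+1) = 0, then [f |-> p \o f \o p] is a linear
    projector of S^c with image S^ii ([schur_ii_cut], [schur_cut_id]). It
    extends to the scalar extension along L ([base_change_map], [schurL_iiP]).

    The projector fixes e_A for A in Xi^ii and kills e_A for the other A in Xi
    ([schur_cut_eA]). This is read off from A = kappa(l, g, m), once it is known
    that the entry 0 (resp. r + 1) of row_c(A) vanishes exactly when l_0 (resp.
    l_(r+1)) does, and similarly for col_c(A) and m ([kappa_Xi_ii]): the block
    R_0 of l is an interval centred at the fixed point 0 of g, and its
    intersections with the blocks g R_j are all empty but one, which has one
    element, exactly when the interval is reduced to its centre.

    Since A <=_alg B implies that A and B have the same row and column sums,
    the element {A} - [A] only involves matrices B that are in Xi^ii if and
    only if A is. So the projector also fixes {A} for A in Xi^ii and kills the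
    other elements of the canonical basis ([schurL_cut_canonical]). The
    elements that it fixes then form a basis of its image ([basis_cut]), and no
    other element of the basis, being nonzero, lies in this image. Bar
    invariance and unitriangularity are inherited. *)

Set Implicit Arguments.
Unset Strict Implicit.
Unset Printing Implicit Defensive.

Local Open Scope classical_set_scope.

(** * Scalar extension of linear maps *)

Section ScalarExtension.
Import GRing.Theory.
Local Open Scope ring_scope.
Variables (R : nzRingType).

Lemma quotmod_pi_subW (V : lmodType R) (rel : set V) (P : {pred V}) x y :
  GRing.submod_closed P -> (forall z, rel z -> z \in P) ->
  quotmod_pi rel x = quotmod_pi rel y -> x - y \in P.
Proof. by move=> Pc relP /quotmod_piP/asboolP; apply. Qed.

Variables (A : nzRingType) (phi : A -> R) (M : lmodType A).
Local Notation B := (base_change phi M).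
Local Notation tens := (@tens A R phi M).
Implicit Types (x y : {malg R[M]}) (h : M -> M).

(** The class of the formal combination [x] of elements of [M]; the class of
    [<< m >>] is [1 (x) m]. *)
Definition base_change_pi x : B := quotmod_pi (@tens_rel A R phi M) x.
Local Notation pi := base_change_pi.

Lemma base_change_piD x y : pi (x + y) = pi x + pi y.
Proof. exact: quotmod_piD. Qed.

Lemma base_change_piZ c x : pi (c *: x) = c *: pi x.
Proof. exact: esym (quotmod_scaleE _ _ _). Qed.

Lemma base_change_piB x y : pi (x - y) = pi x - pi y.
Proof. by rewrite -scaleN1r base_change_piD base_change_piZ scaleN1r. Qed.

Lemma base_change_pi_rel x : @tens_rel A R phi M x -> pi x = 0.
Proof.
move=> relx; rewrite -[RHS](_ : pi 0 = 0).
  by apply/quotmod_piP; rewrite subr0; apply/asboolP => P _; apply.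
by rewrite -(scale0r 0) base_change_piZ scale0r.
Qed.

Lemma base_change_surj (x : B) : exists y, x = pi y.
Proof.
by exists (repr (x : quotmod (@tens_rel A R phi M))); rewrite /pi quotmod_reprK.
Qed.

Lemma tensD m m' : tens (m + m') = tens m + tens m'.
Proof.
apply/eqP; rewrite -subr_eq0 opprD addrA; apply/eqP.
rewrite /Defs.tens -/(pi _) -!base_change_piB; apply: base_change_pi_rel.
exact: tens_add.
Qed.

Lemma tens0 : tens 0 = 0.
Proof. by apply: (addrI (tens 0)); rewrite -tensD !addr0. Qed.

Lemma tensZ a m : tens (a *: m) = phi a *: tens m.
Proof.
apply/eqP; rewrite -subr_eq0; apply/eqP.
rewrite -base_change_piZ /Defs.tens -/(pi _) -!base_change_piB.
apply: base_change_pi_rel; exact: tens_scale.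
Qed.

(** [sum_m r_m << m >> |-> sum_m r_m (1 (x) h m)], for any function [h]. *)
Definition free_map h x : B := \sum_(m <- msupp x) x@_m *: tens (h m).

Lemma free_mapEw (D : {fset M}) h x : (msupp x `<=` D)%fset ->
  free_map h x = \sum_(m <- D) x@_m *: tens (h m).
Proof.
move=> sD; apply: big_fset_incl => // m _ /mcoeff_outdom ->.
by rewrite scale0r.
Qed.

Lemma free_mapD h x y : free_map h (x + y) = free_map h x + free_map h y.
Proof.
rewrite (free_mapEw h (msuppD_le x y)).
rewrite (free_mapEw h (fsubsetUl (msupp x) (msupp y))).
rewrite (free_mapEw h (fsubsetUr (msupp x) (msupp y))).
by rewrite -big_split; apply: eq_bigr => m _; rewrite mcoeffD scalerDl.
Qed.

Lemma free_mapZ h c x : free_map h (c *: x) = c *: free_map h x.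
Proof.
rewrite (free_mapEw h (msuppZ_le c x)) scaler_sumr.
by apply: eq_bigr => m _; rewrite mcoeffZ scalerA.
Qed.

Lemma free_mapB h x y : free_map h (x - y) = free_map h x - free_map h y.
Proof. by rewrite -scaleN1r free_mapD free_mapZ scaleN1r. Qed.

Lemma free_mapU h m : free_map h << m >> = tens (h m).
Proof. by rewrite (free_mapEw h msuppU_le) big_seq_fset1 mcoeffUU scale1r. Qed.

Section LinearMap.
Variable h : {linear M -> M}.

Lemma free_map_kernel : GRing.submod_closed (fun x => free_map h x == 0).
Proof.
split=> [|c x y]; first by apply/eqP; rewrite -(scale0r 0) free_mapZ scale0r.
by move=> /eqP x0 /eqP y0; apply/eqP; rewrite free_mapD free_mapZ x0 y0 scaler0 addr0.
Qed.

Lemma free_map_rel x : @tens_rel A R phi M x -> free_map h x = 0.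
Proof.
case=> [m m'|a m]; rewrite !free_mapB ?free_mapZ !free_mapU.
  by rewrite linearD tensD [_ + _ - _]addrAC addrK subrr.
by rewrite linearZ tensZ subrr.
Qed.

(** The base change [id (x) h] of [h]. It needs no compatibility of [phi] with
    the ring structures, since every linear [h] maps relators of the scalar
    extension to relators. *)
Definition base_change_map : B -> B := @tens_map A R phi M idfun h.

Lemma base_change_map_pi x : base_change_map (pi x) = free_map h x.
Proof.
apply/eqP; rewrite -subr_eq0 -/(free_map h _) -free_mapB.
apply: (quotmod_pi_subW (rel := @tens_rel A R phi M) free_map_kernel) => [y rely|].
  by rewrite unfold_in /= free_map_rel.
exact: quotmod_reprK.
Qed.

Lemma base_change_map_tens m : base_change_map (tens m) = tens (h m).
Proof. by rewrite base_change_map_pi free_mapU. Qed.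

Lemma base_change_map_linear c u v :
  base_change_map (c *: u + v) = c *: base_change_map u + base_change_map v.
Proof.
have [x ->] := base_change_surj u; have [y ->] := base_change_surj v.
rewrite -base_change_piZ -base_change_piD !base_change_map_pi.
by rewrite free_mapD free_mapZ.
Qed.

HB.instance Definition _ :=
  GRing.isLinear.Build R B B _ base_change_map base_change_map_linear.

Lemma base_change_mapE u : exists s : seq (R * M),
  base_change_map u = \sum_(p <- s) p.1 *: tens (h p.2).
Proof.
have [x ->] := base_change_surj u.
exists [seq (x@_m, m) | m <- msupp x].
by rewrite base_change_map_pi big_map.
Qed.

End LinearMap.

End ScalarExtension.

(** * The idempotent truncation of the Schur algebra *)

Section Truncation.
Import GRing.Theory.
Local Open Scope ring_scope.
Variables r d : nat.
Local Notation dsum := (dsum r d).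
Local Notation schur := (schur r d).
Implicit Types (m : dsum) (f g : schur).

Fact dsum_cut_subproof m :
  [ffun l => if comp_ii l then val m l else 0] \in @dsum_pred r d.
Proof.
apply/asboolP => l; rewrite ffunE; case: ifP => _; last by exists 0; rewrite mulr0.
by have /asboolP := valP m; apply.
Qed.

(** The projection onto the sum of the summands [x_l H], [l] in Lambda^ii. *)
Definition dsum_cut m : dsum := Dsum (dsum_cut_subproof m).

Lemma dsum_cutE m l : val (dsum_cut m) l = if comp_ii l then val m l else 0.
Proof. by rewrite ffunE. Qed.

Lemma dsumP m m' : (forall l, val m l = val m' l) -> m = m'.
Proof. by move=> e; apply/val_inj/ffunP. Qed.

Lemma dsum_valD m m' l : val (m + m') l = val m l + val m' l.
Proof. by rewrite /= ffunE. Qed.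

Lemma dsum_valZ c m l : val (c *: m) l = c *: val m l.
Proof. by rewrite /= ffunE. Qed.

Lemma dsum_val0 l : val (0 : dsum) l = 0.
Proof. by rewrite /= ffunE. Qed.

Lemma dsum_actE m h l : val (dsum_act m h) l = val m l * h.
Proof. by rewrite /= ffunE. Qed.

Lemma dsum_cutD m m' : dsum_cut (m + m') = dsum_cut m + dsum_cut m'.
Proof.
apply: dsumP => l; rewrite dsum_valD !dsum_cutE dsum_valD.
by case: ifP; rewrite ?addr0.
Qed.

Lemma dsum_cutZ c m : dsum_cut (c *: m) = c *: dsum_cut m.
Proof.
apply: dsumP => l; rewrite dsum_valZ !dsum_cutE dsum_valZ.
by case: ifP; rewrite ?scaler0.
Qed.

Lemma dsum_cut_act m h : dsum_cut (dsum_act m h) = dsum_act (dsum_cut m) h.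
Proof.
apply: dsumP => l; rewrite dsum_actE !dsum_cutE dsum_actE.
by case: ifP; rewrite ?mul0r.
Qed.

Lemma dsum_cut_gen k : dsum_cut (dsum_gen k) = if comp_ii k then dsum_gen k else 0.
Proof.
apply: dsumP => l; rewrite dsum_cutE (fun_if val) (fun_if (fun F => fun_of_fin F l)).
rewrite dsum_val0 /= ffunE; case: (eqVneq l k) => [->|_] //.
by rewrite !if_same.
Qed.

Lemma schur_add f m m' : f (m + m') = f m + f m'.
Proof. by have /asboolP[fD _] := valP f; apply: fD. Qed.

Lemma schur_act f m h : f (dsum_act m h) = dsum_act (f m) h.
Proof. by have /asboolP[_ fM] := valP f; apply: fM. Qed.

Lemma schur0 f : f 0 = 0.
Proof. by apply: (addrI (f 0)); rewrite -schur_add !addr0. Qed.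

(** An endomorphism is determined by its values on the generators [x_k]. *)
Lemma schur_gen_inj f g : (forall k, f (dsum_gen k) = g (dsum_gen k)) -> f = g.
Proof.
move=> efg; apply/val_inj/funext => m.
have /asboolP/boolp.choice [h mE] := valP m.
have {mE} -> : m = \sum_k dsum_act (dsum_gen k) (h k).
  apply: dsumP => l.
  rewrite (big_morph (fun m : dsum => val m l) (fun m m' => dsum_valD m m' l) (dsum_val0 l)).
  rewrite (bigD1 l) //= big1 => [|k kl]; rewrite !ffunE ?eqxx ?addr0 //.
  by rewrite eq_sym (negPf kl) mul0r.
rewrite /= !(big_morph _ (schur_add _) (schur0 _)).
by apply: eq_bigr => k _; rewrite !schur_act efg.
Qed.

Fact schur_cut_subproof f : dsum_cut \o f \o dsum_cut \in @schur_pred r d.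
Proof.
apply/asboolP; split=> [m m'|m h] /=; first by rewrite !(dsum_cutD, schur_add).
by rewrite !(dsum_cut_act, schur_act).
Qed.

(** [f] multiplied on both sides by the idempotent [dsum_cut]. *)
Definition schur_cut f : schur := Schur (schur_cut_subproof f).

Lemma schur_cutE f m : schur_cut f m = dsum_cut (f (dsum_cut m)).
Proof. by []. Qed.

Lemma schur_valD f g m : (f + g) m = f m + g m.
Proof. by []. Qed.

Lemma schur_valZ c f m : (c *: f) m = c *: f m.
Proof. by []. Qed.

Lemma schur_cut_linear c f g : schur_cut (c *: f + g) = c *: schur_cut f + schur_cut g.
Proof.
apply: schur_gen_inj => k.
rewrite schur_valD schur_valZ !schur_cutE schur_valD schur_valZ.
by rewrite dsum_cutD dsum_cutZ.
Qed.

HB.instance Definition _ :=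
  GRing.isLinear.Build laurent3 schur schur _ schur_cut schur_cut_linear.

(** Together with [schur_cut_id] : [schur_cut] is a projector with image
    [schur_ii]. *)
Lemma schur_ii_cut f : schur_ii r d (schur_cut f).
Proof.
split=> [m m0|m l]; last by rewrite schur_cutE dsum_cutE => /negPf ->.
suff -> : schur_cut f m = schur_cut f 0 by rewrite schur0.
rewrite !schur_cutE; congr (dsum_cut (f _)).
apply: dsumP => l; rewrite !dsum_cutE dsum_val0; case: ifP => // /m0 -> //.
Qed.

Lemma schur_cut_id f : schur_ii r d f -> schur_cut f = f.
Proof.
move=> [fsrc ftgt]; apply: schur_gen_inj => k.
rewrite schur_cutE dsum_cut_gen; case: ifP => [_|kN].
  by apply: dsumP => l; rewrite dsum_cutE; case: ifP => // /negbT /ftgt ->.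
rewrite schur0 [RHS]fsrc => [|l lii]; last first.
  by rewrite /= ffunE; case: eqP => // lk; rewrite lk kN in lii.
by apply: dsumP => l; rewrite dsum_cutE dsum_val0 if_same.
Qed.

End Truncation.

(** * The blocks of a composition *)

Section Blocks.
Import Order.TTheory GRing.Theory Num.Theory.
Local Open Scope ring_scope.
Variables r d : nat.
Implicit Types l m : comp r d.

Lemma part_le m k : (part m k <= d)%N.
Proof. by rewrite /part -ltnS ltn_ord. Qed.

Lemma psum_rec m k : psum m k.+1 = (psum m k + part m k.+1)%N.
Proof. by rewrite /psum big_ord_recr. Qed.

Lemma psum_0 m : psum m 0 = part m 0.
Proof. by rewrite /psum big_ord1. Qed.

Lemma psum_last m : psum m r.+1 = d.
Proof.
rewrite /psum -[RHS](eqP (valP m)); apply: eq_bigr => i _.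
by rewrite /part inord_val.
Qed.

Lemma psum_leq m k k' : (k <= k')%N -> (psum m k <= psum m k')%N.
Proof.
move=> /subnKC <-; elim: (k' - k)%N => [|n IH]; first by rewrite addn0.
by rewrite addnS psum_rec (leq_trans IH) ?leq_addr.
Qed.

Lemma psum_le m k : (k <= r.+1)%N -> (psum m k <= d)%N.
Proof. by move=> kr; rewrite -[leqRHS](psum_last m) psum_leq. Qed.

Lemma block0_bounds m k x : (0 < k <= r)%N -> block0 m k x ->
  (1 <= x :> int) && (x <= d%:Z).
Proof.
move=> kr; rewrite /block0 /=; have -> : (k == 0%N) = false by lia.
have -> : (k == r.+1) = false by lia.
have := @psum_le m k; move=> /= ? ?; lia.
Qed.

Lemma block0_first m x : block0 m 0 x <-> `|x| <= (part m 0)%:Z.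
Proof. by rewrite /block0 /=; lia. Qed.

Lemma block0_last m x :
  block0 m r.+1 x <-> `|x - d.+1%:Z| <= (part m r.+1)%:Z.
Proof. by rewrite /block0 eqxx /=; lia. Qed.

(** The blocks [R_0], ..., [R_(r+1)] cover [0..d+1]. *)
Lemma block0_cover m (z : nat) : (z <= d.+1)%N ->
  exists2 k, (k <= r.+1)%N & block0 m k z%:Z.
Proof.
rewrite leq_eqVlt => /orP[/eqP ->|zd].
  by exists r.+1 => //; apply/block0_last; lia.
have exk : exists k, (z <= psum m k)%N by exists r.+1; rewrite psum_last.
case: (ex_minnP exk) => k zk kmin; have kr : (k <= r.+1)%N.
  by apply: kmin; rewrite psum_last.
case: k zk kmin kr => [|k] zk kmin kr.
  by exists 0%N => //; apply/block0_first; rewrite psum_0 in zk; lia.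
(* k.+1 is the least index k' with z <= psum m k'. *)
have zk' : (psum m k < z)%N.
  by rewrite ltnNge; apply/negP => /kmin; rewrite ltnn.
exists k.+1 => //; have := psum_rec m k.
have [kE|kE] := eqVneq k r.
  by rewrite kE in zk' zk *; rewrite psum_last => psumE; apply/block0_last; lia.
have kF : (k.+1 == r.+1) = false by lia.
by move=> _; rewrite /block0 /= kF /=; lia.
Qed.

(** [block] at an index given by its Euclidean division by n. *)
Lemma block_split m (q : int) (k : nat) x : (k < 2 * r + 2)%N ->
  block m (q * msize r + k%:Z) x <->
  if (k <= r.+1)%N then block0 m k (x - q * period d)
  else block0 m (2 * r + 2 - k)%N (period d - (x - q * period d)).
Proof.
move=> kn; rewrite /block.
have n0 : msize r != 0 by rewrite /msize; lia.
have k_small : 0 <= k%:Z < `|msize r| by rewrite /msize; lia.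
rewrite divzMDl // modzMDl divz_small // modz_small ?addr0; last first.
  by rewrite /msize; lia.
by case: ifP.
Qed.

Lemma euclid_int (n : nat) (j : int) : (0 < n)%N ->
  exists q (k : nat), (k < n)%N /\ j = q * n%:Z + k%:Z.
Proof.
move=> n0; exists (j %/ n)%Z, `|(j %% n)%Z|%N.
have n0' : n%:Z != 0 by lia.
have := modz_ge0 j n0'; have := @ltz_pmod j n; have := divz_eq j n.
by split; lia.
Qed.

Lemma block_index (j : int) :
  exists q (k : nat), (k < 2 * r + 2)%N /\ j = q * msize r + k%:Z.
Proof. by apply: euclid_int; lia. Qed.

(** The blocks [R_j], [j] in [Z], cover [Z]. *)
Lemma block_cover m x : exists j, block m j x.
Proof.
have [q [y [yD xE]]] : exists q (y : nat),
    (y < 2 * d + 2)%N /\ x = q * period d + y%:Z.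
  by apply: euclid_int; lia.
have xq : x - q * period d = y%:Z by lia.
have [yd|yd] := leqP y d.+1.
  have [k kr kP] := block0_cover m yd.
  exists (q * msize r + k%:Z); apply/block_split; first by lia.
  by rewrite kr xq.
have /(block0_cover m)[k kr kP] : (2 * d + 2 - y <= d.+1)%N by lia.
have [k0|k0] := posnP k.
  (* y - D lies in R_0, which is symmetric, so y lies in R_n = R_0 + D. *)
  exists ((q + 1) * msize r + 0%N%:Z); apply/block_split; first by lia.
  rewrite k0 in kP; move/block0_first: kP => kP.
  by apply/block0_first; rewrite mulrDl mul1r opprD addrA xq /period; lia.
have [kE|kE] := eqVneq k r.+1.
  (* R_(r+1) is symmetric under y |-> D - y. *)
  exists (q * msize r + k%:Z); apply/block_split; first by lia.
  rewrite kr xq kE; apply/block0_last; rewrite kE in kP.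
  by move/block0_last: kP; lia.
(* y lies in D - R_k = R_(n-k). *)
exists (q * msize r + (2 * r + 2 - k)%N%:Z); apply/block_split; first by lia.
have -> : (2 * r + 2 - k <= r.+1)%N = false by lia.
have -> : (2 * r + 2 - (2 * r + 2 - k))%N = k by lia.
rewrite xq; suff -> : period d - y%:Z = (2 * d + 2 - y)%N by [].
by rewrite /period; lia.
Qed.

Lemma block_at0 m x : block m 0 x <-> `|x| <= (part m 0)%:Z.
Proof.
have -> : (0 : int) = 0 * msize r + 0%N%:Z by [].
rewrite block_split; last by lia.
by rewrite leq0n mul0r subr0; exact: block0_first.
Qed.

Lemma block_atr1 m x :
  block m r.+1%:Z x <-> `|x - d.+1%:Z| <= (part m r.+1)%:Z.
Proof.
have -> : r.+1%:Z = 0 * msize r + r.+1%:Z by rewrite mul0r add0r.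
rewrite block_split; last by lia.
by rewrite leqnn mul0r subr0; exact: block0_last.
Qed.

(** [0], and likewise [d + 1] in the next lemma, lies in one block only. *)
Lemma block_of0 m j : block m j 0 -> j = 0.
Proof.
have [q [k [kn ->]]] := block_index j; rewrite block_split // sub0r.
have p0 := part_le m 0; have pr := part_le m r.+1.
have q3 : q <= -1 \/ q = 0 \/ 1 <= q by lia.
case: ifP => kr; last first.
  move=> /block0_bounds; have -> : (0 < 2 * r + 2 - k <= r)%N by lia.
  by move=> /(_ isT); rewrite /period; nia.
have [->|k0] := posnP k.
  by move=> /block0_first; rewrite /period; nia.
have [->|kE] := eqVneq k r.+1.
  by move=> /block0_last; rewrite /period; nia.
move=> /block0_bounds; have -> : (0 < k <= r)%N by lia.
by move=> /(_ isT); rewrite /period; nia.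
Qed.

Lemma block_of_half m j : block m j d.+1%:Z -> j = r.+1%:Z.
Proof.
have [q [k [kn ->]]] := block_index j; rewrite block_split //.
have p0 := part_le m 0; have pr := part_le m r.+1.
have q3 : q <= -1 \/ q = 0 \/ 1 <= q by lia.
case: ifP => kr; last first.
  move=> /block0_bounds; have -> : (0 < 2 * r + 2 - k <= r)%N by lia.
  by move=> /(_ isT); rewrite /period; nia.
have [->|k0] := posnP k.
  by move=> /block0_first; rewrite /period; nia.
have [->|kE] := eqVneq k r.+1.
  by move=> /block0_last; rewrite /period; nia.
move=> /block0_bounds; have -> : (0 < k <= r)%N by lia.
by move=> /(_ isT); rewrite /period; nia.
Qed.

End Blocks.

(** * Vanishing of the central row and column sums *)

Section CentralRows.
Import Order.TTheory GRing.Theory Num.Theory.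
Local Open Scope ring_scope.

Lemma finite_int_ball (c : int) (n : nat) : finite_set [set x : int | `|x - c| <= n%:Z].
Proof.
apply: (sub_finite_set (B := (fun k : nat => c - n%:Z + k%:Z) @` `I_(2 * n).+1)).
  move=> x /= xn; exists (absz (x - c + n%:Z)%R); lia.
by apply: finite_image; exact: finite_II.
Qed.

(** Finite support matters here, because an infinitely supported sum is [0]. *)
Lemma sum1_eq0 (X : set int) (f : int -> nat) :
  finite_set [set j | f j != 0%N] ->
  sum1 X f = 0%N <-> (forall j, X j -> f j = 0%N).
Proof.
move=> finf; split=> [sum0 j Xj|f0]; last by rewrite /sum1 fsbig1.
have finX : finite_set (X `&` [set j | f j != 0%N]) by exact: finite_setIr.
apply/eqP; apply/negP => /negP fj.
have : sum1 X f = (\sum_(i <- fset_set (X `&` [set j | f j != 0%N])) f i)%N.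
  rewrite -fsbig_finite // /sum1; apply/esym/fsbig_widen => [i []//|i [Xi]].
  by move=> /= nfi; apply: contrapT => /eqP fi; apply: nfi.
rewrite sum0 => /esym/eqP; rewrite sum_nat_seq_eq0 => /allP /(_ j).
rewrite in_fset_set // inE /= => /(_ (conj Xj fj)).
by rewrite (negPf fj).
Qed.

Variable r : nat.
Local Notation r1 := (r.+1%:Z).
Implicit Types A : zmat.

(** The conditions that define [Xi], without the one on the sum of the entries;
    they are stable under transposition ([centro_sym_tr]). *)
Definition centro_sym A : Prop :=
  [/\ forall i j, A (- i) (- j) = A i j,
      forall i j, A (i + msize r) (j + msize r) = A i j,
      odd (A 0 0) && odd (A r1 r1)
    & forall i, finite_set [set j | A i j != 0%N]].

Lemma Xi_centro_sym d A : Xi r d A -> centro_sym A.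
Proof. by case. Qed.

Lemma periodM A (q : nat) i j :
  (forall i j, A (i + msize r) (j + msize r) = A i j) ->
  A (i + q%:Z * msize r) (j + q%:Z * msize r) = A i j.
Proof.
move=> Aper; elim: q => [|q IH]; first by rewrite !mul0r !addr0.
by rewrite intS mulrDl mul1r ![msize r + _]addrC !addrA Aper.
Qed.

Lemma periodZ A (q : int) i j :
  (forall i j, A (i + msize r) (j + msize r) = A i j) ->
  A (i + q * msize r) (j + q * msize r) = A i j.
Proof.
move=> Aper; case: (intP q) => [|n|n]; first by rewrite !mul0r !addr0.
  exact: periodM.
by rewrite !mulNr -[LHS](periodM n.+1 _ _ Aper) !subrK.
Qed.

(** Up to a simultaneous shift of rows and columns, the column [j] meets only
    [n] rows, so it is finitely supported if the rows are. *)
Lemma centro_sym_tr A : centro_sym A -> centro_sym (fun i j => A j i).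
Proof.
move=> [Asym Aper Aodd Afin]; split=> // j.
apply: (sub_finite_set (B := \bigcup_(k in `I_(2 * r + 2))
   (fun j' : int => k%:Z + (j - j')) @` [set j' | A k%:Z j' != 0%N])).
  move=> i /= Aij; have [q [k [kn iE]]] := block_index r i.
  exists k => //; exists (j - q * msize r) => /=; last by rewrite iE; lia.
  rewrite -(periodZ q _ _ Aper) subrK; apply: contraNN Aij => /eqP <-.
  by rewrite iE addrC.
apply: bigcup_finite => [|k _]; first exact: finite_II.
exact/finite_image/Afin.
Qed.

(** As [A 0 0] is odd, its contribution [(A 0 0 - 1) / 2] to the row sum vanishes
    only if it is [1]; by symmetry the row has no other nonzero entry. *)
Lemma rowc_first_eq0 A : centro_sym A ->
  rowc r A ord0 = 0%N <-> A 0 0 = 1%N /\ forall j, j <> 0 -> A 0 j = 0%N.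
Proof.
move=> [Asym _ /andP[A0odd _] Afin]; rewrite ffunE /aprime !eqxx /=.
split=> [/eqP|[-> A0]]; last first.
  by rewrite add0n; apply/sum1_eq0 => // j /= j1; apply: A0; lia.
rewrite addn_eq0 => /andP[/eqP A00 /eqP /(sum1_eq0 _ (Afin 0)) A0].
split=> [|j j0]; first by move: A0odd A00; lia.
have [j1|j1] := leP 1 j; first exact: A0.
by rewrite -Asym oppr0; apply: A0 => /=; lia.
Qed.

Lemma rowc_last_eq0 A : centro_sym A ->
  rowc r A ord_max = 0%N <->
  A r1 r1 = 1%N /\ forall j, j <> r1 -> A r1 j = 0%N.
Proof.
move=> [Asym Aper /andP[_ A1odd] Afin]; rewrite ffunE /aprime !eqxx orbT /=.
split=> [/eqP|[-> A0]]; last first.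
  by rewrite add0n; apply/sum1_eq0 => // j /= jr; apply: A0; lia.
rewrite addn_eq0 => /andP[/eqP A11 /eqP /(sum1_eq0 _ (Afin r1)) A0].
split=> [|j jr]; first by move: A1odd A11; lia.
have [jr'|jr'] := leP j r; first exact: A0.
have -> : A r1 j = A r1 (msize r - j).
  by rewrite -Asym -Aper; congr A; rewrite /msize; lia.
by apply: A0 => /=; rewrite /msize; lia.
Qed.

End CentralRows.

(** * The central rows of the matrices kappa(l, g, m) *)

Section Kappa.
Import Order.TTheory GRing.Theory Num.Theory.
Local Open Scope ring_scope.
Variables r d : nat.
Implicit Types (l m : comp r d) (g h : int -> int).

Lemma block_finite m j : finite_set (block m j).
Proof.
have [q [k [kn ->]]] := block_index r j.
have bnd k' x : (k' <= r.+1)%N -> block0 m k' x -> `|x| <= (2 * d + 1)%N%:Z.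
  move=> kr; have [->|k0] := posnP k'.
    by move/block0_first; have := part_le m 0; lia.
  have [->|kE] := eqVneq k' r.+1.
    by move/block0_last; have := part_le m r.+1; lia.
  move/block0_bounds; have -> : (0 < k' <= r)%N by lia.
  by move=> /(_ isT); lia.
have [kr|kr] := leqP k r.+1.
  apply: (sub_finite_set _ (finite_int_ball (q * period d) (2 * d + 1))) => x.
  by rewrite block_split // kr => /bnd; exact.
apply: (sub_finite_set _ (finite_int_ball ((q + 1) * period d) (2 * d + 1))) => x.
rewrite block_split // leqNgt kr /= => /bnd.
have -> : (2 * r + 2 - k <= r.+1)%N by lia.
by move=> /(_ isT); rewrite /=; lia.
Qed.

(** Transposing [kappa] amounts to inverting [g]. *)
Lemma kappa_tr l m g h i j : cancel g h -> cancel h g ->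
  kappa l g m j i = kappa m h l i j.
Proof.
move=> gK hK; rewrite /kappa.
have -> : block l j `&` g @` block m i = g @` (block m i `&` h @` block l j).
  apply/seteqP; split=> [x [lx [y my gy]]|x [y [my [z lz hz]] <-]].
    by exists y => //; split=> //; exists x => //; rewrite -gy gK.
  by split; [rewrite -hz hK | exists y].
rewrite fset_set_image; last exact/finite_setIl/block_finite.
by rewrite card_imfset //; exact: can_inj gK.
Qed.

(** If the block [R_i] of [l] is the interval of radius [p] about a fixed
    point [c] of [g], then the row [i] of [kappa l g m] has the single nonzero
    entry [1], on the diagonal, if and only if [p = 0]. *)
Lemma kappa_central_row l m g h (i c : int) (p : nat) :
  cancel g h -> cancel h g -> g c = c -> block m i c ->
  (forall x, block l i x <-> `|x - c| <= p%:Z) ->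
  (forall j, block m j c -> j = i) ->
  (kappa l g m i i = 1%N /\ forall j, j <> i -> kappa l g m i j = 0%N) <->
  p = 0%N.
Proof.
move=> gK hK gc mc lE mj; have fin j : finite_set (block l i `&` g @` block m j).
  exact/finite_setIl/block_finite.
split=> [[k1 k0]|p0].
  apply/eqP; rewrite eqn0Ngt; apply/negP => p0.
  (* If p > 0, then R_i contains c + 1, which lies in some g R_j. *)
  have l1 : block l i (c + 1) by apply/lE; lia.
  have [j mj1] := block_cover m (h (c + 1)).
  have inj : c + 1 \in fset_set (block l i `&` g @` block m j).
    by rewrite in_fset_set // inE; split=> //; exists (h (c + 1)).
  have [ji|ji] := eqVneq j i; last first.
    have /eqP := k0 j (elimN eqP ji); rewrite cardfs_eq0 => /eqP e.
    by rewrite e inE in inj.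
  rewrite ji in inj; move/eqP: k1; rewrite /kappa => /cardfs1P[x xE].
  have : c \in fset_set (block l i `&` g @` block m i).
    rewrite in_fset_set // inE; split; last by exists c.
    by apply/lE; lia.
  by move: inj; rewrite xE !inE => /eqP <- /eqP; lia.
have sub j x : (block l i `&` g @` block m j) x -> x = c /\ j = i.
  move=> [/lE xc [y my gy]]; have xE : x = c by lia.
  by split=> //; apply: mj; rewrite xE -gc in gy; rewrite -(can_inj gK gy).
split=> [|j ji]; rewrite /kappa.
  have -> : block l i `&` g @` block m i = [set c].
    apply/seteqP; split=> [x /sub[]|x ->] //; split; last by exists c.
    by apply/lE; lia.
  by rewrite fset_set1 cardfs1.
have -> : block l i `&` g @` block m j = set0.
  by apply/seteqP; split=> x // /sub[_ /ji].
by rewrite fset_set0 cardfs0.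
Qed.

Lemma affW_fix0 g : affW d g -> g 0 = 0.
Proof. by move=> [_ _ /(_ 0)]; rewrite oppr0; move: (g 0) => x; lia. Qed.

Lemma affW_fix_half g : affW d g -> g d.+1%:Z = d.+1%:Z.
Proof.
move=> [_ gper godd]; have := gper (- d.+1%:Z); rewrite godd.
have -> : - d.+1%:Z + period d = d.+1%:Z by rewrite /period; lia.
by move: (g _) => x; rewrite /period; lia.
Qed.

Lemma kappa_rowc l m g h : affW d g -> cancel g h -> cancel h g ->
  centro_sym r (kappa l g m) ->
  (rowc r (kappa l g m) ord0 = 0%N <-> part l 0 = 0%N) /\
  (rowc r (kappa l g m) ord_max = 0%N <-> part l r.+1 = 0%N).
Proof.
move=> gW gK hK kS; split.
  rewrite rowc_first_eq0 //; apply: (kappa_central_row gK hK (affW_fix0 gW)).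
  - by apply/block_at0; lia.
  - by move=> x; rewrite subr0; exact: block_at0.
  - by move=> j; exact: block_of0.
rewrite rowc_last_eq0 //; apply: (kappa_central_row gK hK (affW_fix_half gW)).
- by apply/block_atr1; lia.
- by move=> x; exact: block_atr1.
- by move=> j; exact: block_of_half.
Qed.

(** Rows give the condition on [l]; columns give the one on [m], because the
    transpose of [kappa l g m] is [kappa m g^-1 l]. *)
Lemma kappa_Xi_ii l m g : dist l m g -> Xi r d (kappa l g m) ->
  Xi_ii r d (kappa l g m) <-> comp_ii l && comp_ii m.
Proof.
move=> [[gW _] [h [gK hK [hW _]]]] kX; have kS := Xi_centro_sym kX.
have trE : (fun i j => kappa l g m j i) = kappa m h l.
  by apply/funext => i; apply/funext => j; exact: kappa_tr.
have kS' : centro_sym r (kappa m h l) by rewrite -trE; exact: centro_sym_tr.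
have [row0 rowr] := kappa_rowc gW gK hK kS.
have [col0 colr] := kappa_rowc hW hK gK kS'.
rewrite /comp_ii /Xi_ii /colc /= trE; split.
  move=> [_ k0]; have [/row0-> /col0->] := k0 _ (or_introl erefl).
  by have [/rowr-> /colr->] := k0 _ (or_intror erefl).
move=> /andP[/andP[/eqP l0 /eqP lr] /andP[/eqP m0 /eqP mr]]; split=> // k.
case=> ->; first by split; [apply/row0 | apply/col0].
by split; [apply/rowr | apply/colr].
Qed.

End Kappa.

(** * Bases and projectors *)

Section SplitBasis.
Import GRing.Theory.
Local Open Scope ring_scope.
Variables (R : nzRingType) (V : lmodType R) (I : choiceType).
Implicit Types (X Y : set I) (a : I -> R) (b : I -> V) (x : V).

Lemma lincomb_linear (P : {linear V -> V}) X a b x :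
  lincomb X a b x -> lincomb X a (P \o b) (P x).
Proof.
move=> [afin aX ->]; split=> //.
rewrite !fsbig_finite // linear_sum; apply: eq_bigr => i _.
by rewrite linearZ.
Qed.

Lemma lincomb0P X b x : lincomb X (fun=> 0) b x <-> x = 0.
Proof.
have e : [set i : I | (0 : R) != 0] = set0.
  by apply/seteqP; split=> i //=; rewrite eqxx.
split=> [[_ _ ->]|->]; first by rewrite e fsbig_set0.
by split=> [|i|]; rewrite ?e ?fsbig_set0 ?eqxx.
Qed.

Lemma lincomb_delta X b i : X i ->
  lincomb X (fun j => (j == i)%:R) b (b i).
Proof.
move=> Xi; have e : [set j | (j == i)%:R != 0 :> R] = [set i].
  apply/seteqP; split=> j /=; last by move=> ->; rewrite eqxx oner_neq0.
  by case: (eqVneq j i) => [->|_] //; rewrite eqxx.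
split; first by rewrite e; exact: finite_set1.
  by move=> j; case: (eqVneq j i) => [->|_] //; rewrite eqxx.
by rewrite e fsbig_set1 eqxx scale1r.
Qed.

Lemma lincomb_sub X Y a b x : X `<=` Y -> lincomb X a b x -> lincomb Y a b x.
Proof. by move=> XY [afin aX ->]; split=> // i /aX /XY. Qed.

(** A linear map which fixes the [b i], [i] in [Y], and kills the others,
    truncates linear combinations. *)
Lemma lincomb_cut (P : {linear V -> V}) X Y a b x :
  (forall i, X i -> P (b i) = if `[< Y i >] then b i else 0) ->
  lincomb X a b x ->
  lincomb (X `&` Y) (fun i => if `[< Y i >] then a i else 0) b (P x).
Proof.
move=> Pb [afin aX xE]; have [_ _ ->] := lincomb_linear P (And3 afin aX xE).
split.
- apply: sub_finite_set afin => i /=; case: ifP => //.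
  by rewrite eqxx.
- by move=> i; case: asboolP => [Yi /aX Xi|_] //; rewrite eqxx.
apply/esym; transitivity (\sum_(i \in [set i | a i != 0])
    (if `[< Y i >] then a i else 0) *: b i).
  apply: fsbig_widen => i /=; first by case: ifP => //; rewrite eqxx.
  by move=> [_ /negP]; rewrite negbK => /eqP ->; rewrite scale0r.
apply: eq_fsbigr => i; rewrite inE /= => /aX Xi; rewrite Pb //.
by case: ifP; rewrite ?scale0r ?scaler0.
Qed.

Lemma basis_neq0 (N : set V) X b i : is_basis N X b -> X i -> b i <> 0.
Proof.
move=> [bN uniq] Xi bi0; have [a [_ aU]] := uniq _ (bN i Xi).
have := aU _ (lincomb_delta b Xi); rewrite (aU _ ((lincomb0P X b _).2 bi0)).
by move=> /(congr1 (fun f => f i)) /eqP; rewrite eqxx eq_sym oner_eq0.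
Qed.

(** If a linear map fixes some elements of a basis and kills the others, then
    the former form a basis of the space of its fixed points. *)
Lemma basis_cut (P : {linear V -> V}) (N : set V) X Y b :
  Y `<=` X -> is_basis setT X b ->
  (forall i, X i -> P (b i) = if `[< Y i >] then b i else 0) ->
  (forall x, N x <-> P x = x) -> is_basis N Y b.
Proof.
move=> YX [_ bU] Pb NP; split=> [i Yi|x /NP Px].
  by apply/NP; rewrite Pb ?asboolT //; exact: YX.
have [a [ax aU]] := bU x Logic.I; exists a; split=> [|a' /(lincomb_sub YX)/aU] //.
have := lincomb_cut Pb ax; rewrite Px => cx.
have -> : a = fun i => if `[< Y i >] then a i else 0.
  by apply: aU; apply: lincomb_sub cx => i [].
by apply: lincomb_sub cx => i [].
Qed.

End SplitBasis.

(** * The canonical basis and the truncation *)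

Section CanonicalBasis.
Import GRing.Theory.
Local Open Scope ring_scope.
Variables (r d : nat).
Implicit Types A B : zmat.

(** Multiplying [e_A] on both sides by the idempotent of [Lambda^ii] keeps it
    if its source and target summands belong to [Lambda^ii], that is if [A] is
    in [Xi^ii], and kills it otherwise. The default value [0] of [eA], were it
    taken, would satisfy this trivially. *)
Lemma schur_cut_eA A : Xi r d A ->
  schur_cut (eA r d A) = if `[< Xi_ii r d A >] then eA r d A else 0.
Proof.
move=> AX; rewrite /eA; case: xgetP => [f _ [l [g [m [lgm AE fE]]]]|_]; last first.
  by rewrite linear0 if_same.
have iiE : `[< Xi_ii r d A >] = comp_ii l && comp_ii m.
  rewrite -AE in AX *; apply/asboolP/idP; first by move/(kappa_Xi_ii lgm AX).
  by move=> lm; apply/(kappa_Xi_ii lgm AX).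
rewrite iiE; case: ifPn => lm.
  move/andP: lm => [lii mii]; apply: schur_gen_inj => k.
  rewrite schur_cutE dsum_cut_gen; apply: dsumP => l'.
  rewrite dsum_cutE fE ffunE; case: (boolP (comp_ii k)) => kii.
    rewrite fE ffunE; case: (boolP (comp_ii l')) => // l'N.
    by case: (eqVneq l' l) l'N => [->|_ _]; rewrite ?lii // andbF.
  rewrite schur0 dsum_val0 if_same.
  by case: (eqVneq k m) kii => [->|] //; rewrite mii.
apply: schur_gen_inj => k; rewrite schur_cutE dsum_cut_gen.
apply: dsumP => l'; rewrite dsum_cutE dsum_val0.
case: (boolP (comp_ii k)) => kii; last by rewrite schur0 dsum_val0 if_same.
rewrite fE ffunE; case: ifP => // l'ii; case: andP => // -[/eqP km /eqP l'l].
by rewrite -l'l -km l'ii kii in lm.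
Qed.

Variable L : (int -> int) -> nat.

(** The truncation of the specialized Schur algebra. *)
Definition schurL_cut : schurL r d L -> schurL r d L :=
  @base_change_map _ _ (@spec d L) _ (@schur_cut r d).

HB.instance Definition _ := GRing.Linear.on schurL_cut.

Lemma schurL_cut_tens f :
  schurL_cut (tens (@spec d L) f) = tens (@spec d L) (schur_cut f).
Proof. exact: base_change_map_tens. Qed.

Lemma schurL_iiP (x : schurL r d L) : schurL_ii r d L x <-> schurL_cut x = x.
Proof.
split=> [[s [sii ->]]|<-].
  rewrite linear_sum; apply: eq_big_seq => p /sii pii.
  by rewrite linearZ /= schurL_cut_tens schur_cut_id.
have [s sE] := @base_change_mapE _ _ (@spec d L) _ (@schur_cut r d) x.
exists [seq (p.1, schur_cut p.2) | p <- s]; split; last by rewrite big_map; exact: sE.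
by move=> _ /mapP[p _ ->]; exact: schur_ii_cut.
Qed.

Lemma schurL_cut_std A : Xi r d A ->
  schurL_cut (stdL r d L A) = if `[< Xi_ii r d A >] then stdL r d L A else 0.
Proof.
move=> AX; rewrite /stdL schurL_cut_tens /std linearZ /=.
rewrite schur_cut_eA //; case: ifP => // _.
by rewrite scaler0 tens0.
Qed.

Lemma alg_le_Xi_ii A B : Xi r d A -> Xi r d B -> alg_le r B A ->
  Xi_ii r d B <-> Xi_ii r d A.
Proof. by move=> AX BX [rowE colE _]; rewrite /Xi_ii /= rowE colE; tauto. Qed.

(** The canonical basis is unitriangular with respect to an order that
    preserves row and column sums, so the truncation fixes or kills {A} as it
    does [A]. *)
Lemma schurL_cut_canonical (bc : zmat -> schurL r d L) A :
  canonical_basis setT (Xi r d) bc -> Xi r d A ->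
  schurL_cut (bc A) = if `[< Xi_ii r d A >] then bc A else 0.
Proof.
move=> [_ can] AX; have [_ [a tri _]] := can A AX.
have -> : bc A = stdL r d L A + (bc A - stdL r d L A) by rewrite addrC subrK.
have cutB B : (Xi r d `&` [set B | alg_lt r B A]) B ->
    schurL_cut (stdL r d L B) =
    if `[< Xi_ii r d A >] then stdL r d L B else 0.
  move=> [BX [BA _]]; rewrite schurL_cut_std //.
  by congr (if _ then _ else _); apply/asbool_equiv_eq/alg_le_Xi_ii.
rewrite linearD /= schurL_cut_std //.
have [_ _ /= ->] := lincomb_linear schurL_cut tri; have [_ aX ->] := tri.
case: ifP => Aii; rewrite ?add0r; first congr (_ + _).
  by apply: eq_fsbigr => B; rewrite inE /= => /aX /cutB ->; rewrite Aii.
by apply: fsbig1 => B /aX /cutB /= ->; rewrite Aii scaler0.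
Qed.

End CanonicalBasis.

Theorem theorem5p19 (r d : nat) (d_ge2 : (2 <= d)%N)
    (L : (int -> int) -> nat) (L_weight : weight_function d L)
    (bc : zmat -> schurL r d L)
    (bc_canonical : canonical_basis [set: schurL r d L] (Xi r d) bc) :
  exists bii : zmat -> schurL r d L,
    canonical_basis (schurL_ii r d L) (Xi_ii r d) bii /\
    [set bii A | A in Xi_ii r d] =
      [set bc A | A in Xi r d] `&` schurL_ii r d L.
Proof.
have cut_bc A := schurL_cut_canonical (A := A) bc_canonical.
have [bc_basis bc_tri] := bc_canonical.
have Xi_iiW : Xi_ii r d `<=` Xi r d by move=> A [].
exists bc; split; first split.
- exact: (basis_cut Xi_iiW bc_basis cut_bc (@schurL_iiP r d L)).
- move=> A Aii; have AX := Xi_iiW _ Aii; have [bcA [a tri aneg]] := bc_tri A AX.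
  split=> //; exists a => //; apply: lincomb_sub tri => B [BX BA].
  by split=> //; apply/(alg_le_Xi_ii AX BX BA.1).
apply/seteqP; split=> [_ [A Aii <-]|_ [[A AX <-] /schurL_iiP]].
  have AX := Xi_iiW _ Aii; split; first by exists A.
  by apply/schurL_iiP; rewrite cut_bc ?asboolT.
rewrite cut_bc //; case: asboolP => [Aii _|_ bc0]; first by exists A.
by case: (basis_neq0 bc_basis AX).
Qed.
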